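(* Let $m_1,m_2$ be integers greater than $1$, not necessarily coprime, and let $a_1,a_2$ be integers less than $m_1,m_2$ respectively. Let $d=\gcd(m_1,m_2)$ and suppose $d\mid(a_1-a_2)$. Then the solution of the system $$x\equiv a_1\pmod{m_1},\qquad x\equiv a_2\pmod{m_2}$$ is given by $$x=m_1\,\bigl((a_2-a_1)(m_1^{-1})_{m_2}\bigr)_{m_2}+a_1+k\,\frac{m_1m_2}{d},\qquad k\in\mathbb{Z}$$ (that is, the integers $x$ solving the system are those of this form), where, with $a=(a_2-a_1)_{m_2}$, $$\bigl((a_2-a_1)(m_1^{-1})_{m_2}\bigr)_{m_2}=\left(\left(\frac{a}{d}\right)\left(\frac{m_1}{d}\right)^{-1}_{\frac{m_2}{d}}\right)_{\frac{m_2}{d}} .$$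
   Context: For integers $a$ and $m\neq0$, $(a)_m:=a-m\lfloor a/m\rfloor$. Extended modular inverse: for integers $a,b,m$ with $m\ne 0$ and $g=\gcd(a,m)$, the symbol $(b(a^{-1})_m)_m$ (also written $(b\,(a)^{-1}_m)_m$) denotes: (i) if $g=1$, $(x)_m$, where $x$ is any integer with $ax\equiv b\pmod m$; (ii) if $g\neq1$ and $g\mid b$, $(x)_{m/g}$, where $x$ is any integer with $(a/g)x\equiv b/g\pmod{m/g}$; (iii) undefined if $g\nmid b$. *)

(* Defs.v *)
From Stdlib Require Import ZArith.
Open Scope Z_scope.

(* The residue (a)_m = a - m * floor (a / m) is [a mod m] of Stdlib, whose
   division rounds towards minus infinity for m of either sign. *)

Definition congr (m x y : Z) : Prop := (m | x - y).

(* [y] is the value of "(x)_m, where x is any integer with a x = b (mod m)":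
   such an x exists, and all of them give this same y. *)
Definition residue_of_solutions (a b m y : Z) : Prop :=
  (exists x, congr m (a * x) b) /\
  (forall x, congr m (a * x) b -> y = x mod m).

(* [ext_modinv b a m y]: the symbol (b (a^-1)_m)_m is defined and denotes y.
   The symbol is partial: no y is related when gcd(a, m) does not divide b. *)
Definition ext_modinv (b a m y : Z) : Prop :=
  m <> 0 /\
  let g := Z.gcd a m in
  (g = 1 /\ residue_of_solutions a b m y) \/
  (g <> 1 /\ (g | b) /\ residue_of_solutions (a / g) (b / g) (m / g) y).

(* Main.v *)
(** Write [m1 = d p], [m2 = d q] with [p], [q] coprime and [a2 - a1 = d c].  A
    solution of the first congruence is [a1 + m1 t], and the second one then
    says [p t = c (mod q)], whose solutions form one residue class mod [q];
    both symbols denote the representative of this class in [[0, q)]. *)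

Require Import Defs.
From Stdlib Require Import ZArith Lia.
Open Scope Z_scope.

(** Bezout gives [u * a + v * m = 1], so [u * b] is a solution; its residue modulo [m] is the one in
    range. *)
Lemma congr_solution_exists (a b m : Z) :
  0 < m -> Z.gcd a m = 1 -> exists y, 0 <= y < m /\ congr m (a * y) b.
Proof.
intros hm hg.
destruct (Z.gcd_bezout a m 1 hg) as [u [v huv]].
exists ((u * b) mod m); split; [now apply Z.mod_pos_bound|].
exists (- v * b - a * (u * b / m)).
pose proof (Z.div_mod (u * b) m ltac:(lia)) as hdm.
replace ((u * b) mod m) with (u * b - m * (u * b / m)) by lia.
(* Only the lone subtracted [b] is multiplied by the Bezout expression for 1; the goal is then a
   polynomial identity with [u * b / m] as an atom. *)
replace b with ((u * a + v * m) * b) at 3 by (rewrite huv; lia).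
ring.
Qed.

(** Subtracting the two congruences leaves [m | a * (x - y)], and Gauss's lemma cancels the coprime
    factor [a]. *)
Lemma congr_solution_iff (a b m y x : Z) :
  Z.gcd a m = 1 -> congr m (a * y) b -> congr m (a * x) b <-> (m | x - y).
Proof.
intros hg hy; split; intros hx.
- apply (Z.gauss m a); [|now rewrite Z.gcd_comm].
  replace (a * (x - y)) with ((a * x - b) - (a * y - b)) by ring.
  now apply Z.divide_sub_r.
- unfold congr.
  replace (a * x - b) with (a * (x - y) + (a * y - b)) by ring.
  apply Z.divide_add_r; [now apply Z.divide_mul_r | exact hy].
Qed.

Lemma residue_of_solutions_intro (a b m y : Z) :
  Z.gcd a m = 1 -> 0 <= y < m -> congr m (a * y) b ->
  residue_of_solutions a b m y.
Proof.
intros hg hy hc; split; [now exists y|].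
intros x hx.
apply (congr_solution_iff a b m y x hg hc) in hx.
destruct hx as [k hk].
replace x with (y + k * m) by lia.
now rewrite Z.mod_add, Z.mod_small by lia.
Qed.

(** Treats both defined cases of the symbol at once: dividing by a gcd equal to 1 changes nothing,
    and after the division the coefficient is always coprime to the modulus. *)
Lemma ext_modinv_intro (a b m y : Z) :
  m <> 0 -> (Z.gcd a m | b) -> 0 <= y < m / Z.gcd a m ->
  congr (m / Z.gcd a m) (a / Z.gcd a m * y) (b / Z.gcd a m) ->
  ext_modinv b a m y.
Proof.
intros hm hb hy hc; split; [exact hm|]; cbv zeta.
assert (hg : Z.gcd a m <> 0) by (rewrite Z.gcd_eq_0; lia).
assert (hr : residue_of_solutions (a / Z.gcd a m) (b / Z.gcd a m)
               (m / Z.gcd a m) y).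
{ apply residue_of_solutions_intro; trivial.
  now apply Z.gcd_div_gcd. }
destruct (Z.eq_dec (Z.gcd a m) 1) as [h1|h1].
- left; split; [exact h1|].
  now rewrite h1, !Z.div_1_r in hr.
- now right.
Qed.

Theorem theorem4p5 (m1 m2 a1 a2 : Z)
  (hm1 : 1 < m1) (hm2 : 1 < m2) (ha1 : a1 < m1) (ha2 : a2 < m2)
  (hd : (Z.gcd m1 m2 | a1 - a2)) :
  let d := Z.gcd m1 m2 in
  let a := (a2 - a1) mod m2 in
  exists e : Z,
    ext_modinv (a2 - a1) m1 m2 e /\
    ext_modinv (a / d) (m1 / d) (m2 / d) e /\
    (forall x : Z,
       congr m1 x a1 /\ congr m2 x a2 <->
       exists k : Z, x = m1 * e + a1 + k * (m1 * m2 / d)).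
Proof.
intros d a.
assert (hd0 : 0 < d).
{ pose proof (Z.gcd_nonneg m1 m2); pose proof (Z.gcd_eq_0 m1 m2); lia. }
assert (hpq : Z.gcd (m1 / d) (m2 / d) = 1) by (apply Z.gcd_div_gcd; lia).
destruct (Z.gcd_divide_l m1 m2) as [p hp].
destruct (Z.gcd_divide_r m1 m2) as [q hq].
destruct hd as [c' hc'].
fold d in hp, hq, hc'.
set (c := - c').
assert (hc : a2 - a1 = c * d) by lia.
assert (hdp : m1 / d = p) by (rewrite hp; apply Z.div_mul; lia).
assert (hdq : m2 / d = q) by (rewrite hq; apply Z.div_mul; lia).
assert (hdc : (a2 - a1) / d = c) by (rewrite hc; apply Z.div_mul; lia).
assert (hq0 : 0 < q) by nia.
(* The factor [d] comes out of the residue: [(c * d) mod (q * d) = (c mod q) * d]. *)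
assert (hda : a / d = c mod q).
{ unfold a; rewrite hc, hq, Z.mul_mod_distr_r by lia; apply Z.div_mul; lia. }
assert (hlcm : m1 * m2 / d = m1 * q).
{ rewrite hq, Z.mul_assoc; apply Z.div_mul; lia. }
rewrite hdp, hdq in hpq.
destruct (congr_solution_exists p c q hq0 hpq) as [e [he hec]].
exists e; split; [|split].
- apply ext_modinv_intro; fold d; rewrite ?hdp, ?hdq, ?hdc; trivial; [lia|].
  now exists c.
(* Here the gcd is already 1, and the right-hand side [c mod q] differs from [c] by a multiple of
   [q], so the same [e] still solves the congruence. *)
- rewrite hda, hdp, hdq.
  apply ext_modinv_intro; rewrite ?hpq, ?Z.div_1_r; trivial;
    [lia | apply Z.divide_1_l |].
  unfold congr.
  replace (p * e - c mod q) with ((p * e - c) + (c / q) * q)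
    by (pose proof (Z.div_mod c q ltac:(lia)); lia).
  apply Z.divide_add_r; [exact hec | apply Z.divide_factor_r].
- intros x; rewrite hlcm.
  (* Since [m2 = q * d], cancelling [d] turns the second congruence for [m1 * t + a1] into
     [p * t = c] modulo [q], of which [e] is a solution. *)
  assert (hm2t : forall t, congr m2 (m1 * t + a1) a2 <-> (q | t - e)).
  { intros t; rewrite <- (congr_solution_iff p c q e t hpq hec).
    unfold congr.
    replace (m1 * t + a1 - a2) with ((p * t - c) * d) by lia.
    rewrite hq; apply Z.mul_divide_cancel_r; lia. }
  split.
  + intros [[t ht] h2].
    replace x with (m1 * t + a1) in h2 |- * by lia.
    apply hm2t in h2; destruct h2 as [k hk].
    exists k; replace t with (k * q + e) by lia; ring.
  + intros [k hk].
    replace x with (m1 * (e + k * q) + a1) by lia.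
    split.
    * exists (e + k * q); ring.
    * apply hm2t; exists k; ring.
Qed.
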